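(* Let $\phi=\phi(x)$ and $\sigma=\sigma(x)$ be smooth functions on an open interval $I$, with $\phi$ nowhere zero on $I$, and let $A,B,C$ be constants. The third-order equation $$\begin{aligned} &\phi^3 y''' + \big[A+3(\phi'-\sigma)\big]\phi^2 y''\\ &+\big[B+A\phi'-2A\sigma+\phi\phi''+(\phi')^2-3(\phi\sigma)'+3\sigma^2\big]\phi\, y'\\ &+\big[C-B\sigma+A\sigma^2-A\phi\sigma'-\sigma^3-\phi^2\sigma''-\phi\phi'\sigma'+3\phi\sigma\sigma'\big]\,y=0 \end{aligned}$$ has the invariant solutions of the form $$y=e^{\int\frac{\sigma(x)+\lambda}{\phi(x)}\,dx},$$ where $\lambda$ satisfies the characteristic equation $$\lambda^3+A\lambda^2+B\lambda+C=0.$$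
   Context: Here $\int g(x)\,dx$ denotes an antiderivative of $g$ on $I$, and $\lambda$ may be complex (in which case the solution is complex-valued). ''Invariant'' means invariant with respect to the operator $$X=\phi(x)\frac{\partial}{\partial x}+(\sigma(x)+\lambda)\,y\,\frac{\partial}{\partial y},$$ i.e. the function $y(x)$ satisfies $\phi(x)y'=(\sigma(x)+\lambda)y$. *)

(* Defs.v *)
(* Stdlib reals with Coquelicot. *)
From Stdlib Require Import Reals.
From Coquelicot Require Import Coquelicot.

Open Scope R_scope.

(* The open interval ]a, b[, whose endpoints may be infinite. *)
Definition Rbar_interval (a b : Rbar) (x : R) : Prop :=
  Rbar_lt a x /\ Rbar_lt x b.

Definition smooth_on (I : R -> Prop) (f : R -> R) : Prop :=
  forall (n : nat) (x : R), I x -> ex_derive_n f n x.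

Definition Cexp (z : C) : C :=
  (exp (Re z) * cos (Im z), exp (Re z) * sin (Im z)).

(* [g] is the derivative on [I] of the complex-valued function [f] of a real
   variable; [C] is taken as a normed space over [R]. *)
Definition derivative_on (I : R -> Prop) (f g : R -> C) : Prop :=
  forall x : R, I x -> @is_derive R_AbsRing C_R_NormedModule f x (g x).

Definition antiderivative_on (I : R -> Prop) (g G : R -> C) : Prop :=
  derivative_on I G g.

(* Invariance of the graph of [y] under
   X = phi(x) d/dx + (sigma(x) + lambda) y d/dy. *)
Definition invariant_on (I : R -> Prop) (phi sigma : R -> R) (lambda : C)
    (y : R -> C) : Prop :=
  exists y' : R -> C, derivative_on I y y' /\
    forall x : R, I x ->
      (RtoC (phi x) * y' x = (RtoC (sigma x) + lambda) * y x)%C.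

(* Coefficients of the equation: [coefk] multiplies the k-th derivative of [y];
   [C0] is the constant term of the characteristic polynomial. *)
Definition coef3 (phi : R -> R) (x : R) : C := RtoC (phi x ^ 3).

Definition coef2 (phi sigma : R -> R) (A : C) (x : R) : C :=
  ((A + RtoC (3 * (Derive phi x - sigma x))) * RtoC (phi x ^ 2))%C.

Definition coef1 (phi sigma : R -> R) (A B : C) (x : R) : C :=
  ((B + A * RtoC (Derive phi x) - 2 * A * RtoC (sigma x)
    + RtoC (phi x * Derive_n phi 2 x + Derive phi x ^ 2
            - 3 * Derive (fun t : R => (phi t * sigma t)%R) x
            + 3 * sigma x ^ 2))
   * RtoC (phi x))%C.

Definition coef0 (phi sigma : R -> R) (A B C0 : C) (x : R) : C :=
  (C0 - B * RtoC (sigma x) + A * RtoC (sigma x ^ 2)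
   - A * RtoC (phi x * Derive sigma x)
   + RtoC (- sigma x ^ 3 - phi x ^ 2 * Derive_n sigma 2 x
           - phi x * Derive phi x * Derive sigma x
           + 3 * phi x * sigma x * Derive sigma x))%C.

Definition solution_on (I : R -> Prop) (phi sigma : R -> R) (A B C0 : C)
    (y : R -> C) : Prop :=
  exists y1 y2 y3 : R -> C,
    derivative_on I y y1 /\ derivative_on I y1 y2 /\ derivative_on I y2 y3 /\
    forall x : R, I x ->
      (coef3 phi x * y3 x + coef2 phi sigma A x * y2 x
       + coef1 phi sigma A B x * y1 x + coef0 phi sigma A B C0 x * y x = 0)%C.

Definition characteristic_root (A B C0 lambda : C) : Prop :=
  (lambda ^ 3 + A * lambda ^ 2 + B * lambda + C0 = 0)%C.

(* Main.v *)
(** Let [D y = phi y' - sigma y].  The left-hand side of the equation is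
    [(D^3 + A D^2 + B D + C) y], while invariance says [D y = lambda y].  On an
    invariant function the left-hand side is therefore the characteristic
    polynomial at [lambda] times [y], and an exponential never vanishes. *)

Require Import Defs.
From Stdlib Require Import Reals Lra.
From Coquelicot Require Import Coquelicot.

Open Scope R_scope.

(** * Calculus of complex-valued functions of a real variable *)

(** Since the real exponential is positive, a zero would make the sine and cosine of [Im z] vanish
    together, against sin^2 + cos^2 = 1. *)
Lemma Cexp_neq_0 (z : C) : Cexp z <> 0%C.
Proof.
  intros H.
  assert (Hre := f_equal fst H). assert (Him := f_equal snd H).
  unfold Cexp in Hre, Him; simpl in Hre, Him.
  assert (He := exp_pos (Re z)).
  assert (Hsc := sin2_cos2 (Im z)). unfold Rsqr in Hsc.
  apply Rmult_integral in Hre. apply Rmult_integral in Him.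
  destruct Hre as [Hre | Hre]; [lra |].
  destruct Him as [Him | Him]; [lra |].
  rewrite Hre, Him in Hsc. lra.
Qed.

(** The first projection is a continuous linear map over the reals, hence its own differential, and
    the chain rule applies. *)
Lemma C_is_derive_Re (f : R -> C) (x : R) (l : C) :
  @is_derive R_AbsRing C_R_NormedModule f x l ->
  is_derive (fun t => Re (f t)) x (Re l).
Proof.
  intros H.
  exact (filterdiff_comp' f (fun z : C_R_NormedModule => Re z) x _ _ H
           (filterdiff_linear _ is_linear_fst)).
Qed.

Lemma C_is_derive_Im (f : R -> C) (x : R) (l : C) :
  @is_derive R_AbsRing C_R_NormedModule f x l ->
  is_derive (fun t => Im (f t)) x (Im l).
Proof.
  intros H.
  exact (filterdiff_comp' f (fun z : C_R_NormedModule => Im z) x _ _ H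
           (filterdiff_linear _ is_linear_snd)).
Qed.

(** Decompose along the real basis 1, i: the pair is [f] times (1, 0) plus [g] times (0, 1), and
    each term is a real function times a constant vector. *)
Lemma C_is_derive_pair (f g : R -> R) (x lf lg : R) :
  is_derive f x lf -> is_derive g x lg ->
  @is_derive R_AbsRing C_R_NormedModule (fun t => (f t, g t)) x (lf, lg).
Proof.
  intros Hf Hg.
  apply (is_derive_scal_l (V := C_R_NormedModule) f x lf (1, 0)) in Hf.
  apply (is_derive_scal_l (V := C_R_NormedModule) g x lg (0, 1)) in Hg.
  assert (H := is_derive_plus _ _ _ _ _ Hf Hg).
  replace ((lf, lg) : C_R_NormedModule)
    with (plus (scal lf ((1, 0) : C_R_NormedModule)) (scal lg ((0, 1) : C_R_NormedModule))).
  - eapply is_derive_ext; [| exact H].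
    intros t. apply injective_projections; cbn; ring.
  - apply injective_projections; cbn; ring.
Qed.

Lemma C_is_derive_components (f : R -> C) (x : R) (l : C) :
  is_derive (fun t => Re (f t)) x (Re l) ->
  is_derive (fun t => Im (f t)) x (Im l) ->
  @is_derive R_AbsRing C_R_NormedModule f x l.
Proof.
  intros Hr Hi.
  assert (H := C_is_derive_pair _ _ _ _ _ Hr Hi).
  rewrite (surjective_pairing l).
  eapply is_derive_ext; [| exact H].
  intros t. symmetry. apply surjective_pairing.
Qed.

Lemma C_is_derive_unique (f : R -> C) (x : R) (l l' : C) :
  @is_derive R_AbsRing C_R_NormedModule f x l ->
  @is_derive R_AbsRing C_R_NormedModule f x l' -> l = l'.
Proof.
  intros H H'. apply injective_projections.
  - transitivity (Derive (fun t => Re (f t)) x).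
    + symmetry. exact (is_derive_unique _ _ _ (C_is_derive_Re _ _ _ H)).
    + exact (is_derive_unique _ _ _ (C_is_derive_Re _ _ _ H')).
  - transitivity (Derive (fun t => Im (f t)) x).
    + symmetry. exact (is_derive_unique _ _ _ (C_is_derive_Im _ _ _ H)).
    + exact (is_derive_unique _ _ _ (C_is_derive_Im _ _ _ H')).
Qed.

(** The real part of a complex product is a difference of two real products and the imaginary part a
    sum of two, so the real product rule serves in each component. *)
Lemma C_is_derive_mult (f g : R -> C) (x : R) (lf lg : C) :
  @is_derive R_AbsRing C_R_NormedModule f x lf ->
  @is_derive R_AbsRing C_R_NormedModule g x lg ->
  @is_derive R_AbsRing C_R_NormedModule (fun t => f t * g t)%C x
    (lf * g x + f x * lg)%C.
Proof.
  intros Hf Hg.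
  assert (Hfr := C_is_derive_Re _ _ _ Hf). assert (Hfi := C_is_derive_Im _ _ _ Hf).
  assert (Hgr := C_is_derive_Re _ _ _ Hg). assert (Hgi := C_is_derive_Im _ _ _ Hg).
  apply C_is_derive_components.
  - assert (H := is_derive_minus _ _ _ _ _
      (is_derive_mult _ _ _ _ _ Hfr Hgr Rmult_comm)
      (is_derive_mult _ _ _ _ _ Hfi Hgi Rmult_comm)).
    match type of H with is_derive _ _ ?d =>
      replace (Re (lf * g x + f x * lg)%C) with d by (cbn; unfold Re, Im; ring) end.
    exact H.
  - assert (H := is_derive_plus _ _ _ _ _
      (is_derive_mult _ _ _ _ _ Hfr Hgi Rmult_comm)
      (is_derive_mult _ _ _ _ _ Hfi Hgr Rmult_comm)).
    match type of H with is_derive _ _ ?d =>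
      replace (Im (lf * g x + f x * lg)%C) with d by (cbn; unfold Re, Im; ring) end.
    exact H.
Qed.

Lemma C_is_derive_plus (f g : R -> C) (x : R) (lf lg : C) :
  @is_derive R_AbsRing C_R_NormedModule f x lf ->
  @is_derive R_AbsRing C_R_NormedModule g x lg ->
  @is_derive R_AbsRing C_R_NormedModule (fun t => f t + g t)%C x (lf + lg)%C.
Proof. exact (is_derive_plus (V := C_R_NormedModule) f g x lf lg). Qed.

Lemma C_is_derive_const (c : C) (x : R) :
  @is_derive R_AbsRing C_R_NormedModule (fun _ => c) x (RtoC 0).
Proof. exact (is_derive_const (V := C_R_NormedModule) c x). Qed.

Lemma C_is_derive_RtoC (f : R -> R) (x l : R) :
  is_derive f x l ->
  @is_derive R_AbsRing C_R_NormedModule (fun t => RtoC (f t)) x (RtoC l).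
Proof.
  intros H. apply C_is_derive_pair; [exact H |].
  exact (is_derive_const (V := R_NormedModule) 0 x).
Qed.

Lemma C_is_derive_Cexp (G : R -> C) (x : R) (g : C) :
  @is_derive R_AbsRing C_R_NormedModule G x g ->
  @is_derive R_AbsRing C_R_NormedModule (fun t => Cexp (G t)) x (g * Cexp (G x))%C.
Proof.
  intros H.
  set (u := fun t => Re (G t)). set (v := fun t => Im (G t)).
  assert (Hu : is_derive u x (Re g)) by exact (C_is_derive_Re _ _ _ H).
  assert (Hv : is_derive v x (Im g)) by exact (C_is_derive_Im _ _ _ H).
  apply C_is_derive_components.
  - change (is_derive (fun t => exp (u t) * cos (v t)) x
      (Re g * (exp (u x) * cos (v x)) - Im g * (exp (u x) * sin (v x)))).
    (* With their bodies hidden, [auto_derive] treats [u] and [v] as atomic functions and leaves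
       their differentiability as side conditions. *)
    clearbody u v.
    auto_derive.
    + split; [exists (Re g); exact Hu | split; [exists (Im g); exact Hv | exact I]].
    + change (Derive (fun t => u t) x) with (Derive u x).
      change (Derive (fun t => v t) x) with (Derive v x).
      rewrite (is_derive_unique _ _ _ Hu), (is_derive_unique _ _ _ Hv). ring.
  - change (is_derive (fun t => exp (u t) * sin (v t)) x
      (Re g * (exp (u x) * sin (v x)) + Im g * (exp (u x) * cos (v x)))).
    clearbody u v.
    auto_derive.
    + split; [exists (Re g); exact Hu | split; [exists (Im g); exact Hv | exact I]].
    + change (Derive (fun t => u t) x) with (Derive u x).
      change (Derive (fun t => v t) x) with (Derive v x).
      rewrite (is_derive_unique _ _ _ Hu), (is_derive_unique _ _ _ Hv). ring.
Qed.

(** * Open intervals and antiderivatives *)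

Lemma Rbar_interval_locally (a b : Rbar) (x : R) :
  Rbar_interval a b x -> locally x (Rbar_interval a b).
Proof.
  intros [Ha Hb]. apply locally_interval with a b; try assumption.
  intros y Hay Hyb. split; assumption.
Qed.

Lemma Rbar_interval_inhabited (a b : Rbar) :
  Rbar_lt a b -> exists x, Rbar_interval a b x.
Proof.
  unfold Rbar_interval.
  destruct a as [a | |], b as [b | |]; cbn; intros H; try contradiction.
  - exists ((a + b) / 2). split; lra.
  - exists (a + 1). split; [lra | exact I].
  - exists (b - 1). split; [exact I | lra].
  - exists 0. split; exact I.
Qed.

Lemma Rbar_interval_convex (a b : Rbar) (x y z : R) :
  Rbar_interval a b x -> Rbar_interval a b y ->
  Rmin x y <= z <= Rmax x y -> Rbar_interval a b z.
Proof.
  intros [Hax Hxb] [Hay Hyb] [Hz1 Hz2]. split.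
  - apply Rbar_lt_le_trans with (Rmin x y); [| exact Hz1].
    unfold Rmin; destruct (Rle_dec x y); assumption.
  - apply Rbar_le_lt_trans with (Rmax x y); [exact Hz2 |].
    unfold Rmax; destruct (Rle_dec x y); assumption.
Qed.

(** Integrate from a base point of the interval. By convexity the segment from it to any other point
    stays inside, where [f] is continuous and so integrable. *)
Lemma continuous_antiderivative (a b : Rbar) (f : R -> R) :
  Rbar_lt a b -> (forall x, Rbar_interval a b x -> continuous f x) ->
  exists F, forall x, Rbar_interval a b x -> is_derive F x (f x).
Proof.
  intros hab Hf. destruct (Rbar_interval_inhabited _ _ hab) as [x0 Hx0].
  exists (RInt f x0). intros x Hx.
  apply is_derive_RInt with x0; [| apply Hf, Hx].
  generalize (Rbar_interval_locally _ _ _ Hx). apply filter_imp. intros y Hy.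
  apply (RInt_correct f), ex_RInt_continuous. intros z Hz.
  apply Hf. apply (Rbar_interval_convex _ _ x0 y); assumption.
Qed.

(** This allows an identity valid on the interval to be differentiated: openness makes it hold near
    each point, and derivatives are local and unique. *)
Lemma derivative_on_eq (a b : Rbar) (f g f' g' : R -> C) :
  derivative_on (Rbar_interval a b) f f' ->
  derivative_on (Rbar_interval a b) g g' ->
  (forall x, Rbar_interval a b x -> f x = g x) ->
  forall x, Rbar_interval a b x -> f' x = g' x.
Proof.
  intros Hf Hg Heq x Hx.
  apply (C_is_derive_unique g x); [| apply Hg, Hx].
  apply is_derive_ext_loc with f; [| apply Hf, Hx].
  generalize (Rbar_interval_locally _ _ _ Hx). apply filter_imp. exact Heq.
Qed.

(** * The differential equation evaluated on an invariant function *)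

Lemma smooth_on_is_derive (I : R -> Prop) (f : R -> R) (x : R) :
  smooth_on I f -> I x -> is_derive f x (Derive f x).
Proof. intros Hf Hx. apply Derive_correct. exact (Hf 1%nat x Hx). Qed.

Lemma smooth_on_is_derive_2 (I : R -> Prop) (f : R -> R) (x : R) :
  smooth_on I f -> I x -> is_derive (Derive f) x (Derive_n f 2 x).
Proof. intros Hf Hx. apply (Derive_correct (Derive f)). exact (Hf 2%nat x Hx). Qed.

(* Differentiating [phi y' = (sigma + lambda) y] twice determines [phi y''] and
   [phi y'''] without ever dividing inside a derivative. *)
Lemma invariant_equation_lhs (a b : Rbar) (phi sigma : R -> R)
  (A B C0 lambda : C) (y y1 y2 y3 : R -> C) :
  smooth_on (Rbar_interval a b) phi ->
  smooth_on (Rbar_interval a b) sigma ->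
  (forall x, Rbar_interval a b x -> phi x <> 0) ->
  derivative_on (Rbar_interval a b) y y1 ->
  derivative_on (Rbar_interval a b) y1 y2 ->
  derivative_on (Rbar_interval a b) y2 y3 ->
  (forall x, Rbar_interval a b x ->
     (RtoC (phi x) * y1 x = (RtoC (sigma x) + lambda) * y x)%C) ->
  forall x, Rbar_interval a b x ->
    (coef3 phi x * y3 x + coef2 phi sigma A x * y2 x
     + coef1 phi sigma A B x * y1 x + coef0 phi sigma A B C0 x * y x
     = (lambda ^ 3 + A * lambda ^ 2 + B * lambda + C0) * y x)%C.
Proof.
  intros hphi hsigma hphi0 Hy Hy1 Hy2 R1.
  set (p1 := Derive phi). set (p2 := Derive_n phi 2).
  set (s1 := Derive sigma). set (s2 := Derive_n sigma 2).
  assert (Dp : derivative_on (Rbar_interval a b) (fun t => RtoC (phi t)) (fun t => RtoC (p1 t))).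
  { intros t Ht. apply C_is_derive_RtoC. exact (smooth_on_is_derive _ _ _ hphi Ht). }
  assert (Dp1 : derivative_on (Rbar_interval a b) (fun t => RtoC (p1 t)) (fun t => RtoC (p2 t))).
  { intros t Ht. apply C_is_derive_RtoC. exact (smooth_on_is_derive_2 _ _ _ hphi Ht). }
  (* The summand 0 is the derivative of the constant [lambda], kept so that the sum rule matches
     syntactically. *)
  assert (Ds : derivative_on (Rbar_interval a b) (fun t => RtoC (sigma t) + lambda)%C
                 (fun t => RtoC (s1 t) + 0)%C).
  { intros t Ht. apply C_is_derive_plus; [| apply C_is_derive_const].
    apply C_is_derive_RtoC. exact (smooth_on_is_derive _ _ _ hsigma Ht). }
  assert (Ds1 : derivative_on (Rbar_interval a b) (fun t => RtoC (s1 t) + 0)%C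
                  (fun t => RtoC (s2 t) + 0)%C).
  { intros t Ht. apply C_is_derive_plus; [| apply C_is_derive_const].
    apply C_is_derive_RtoC. exact (smooth_on_is_derive_2 _ _ _ hsigma Ht). }
  (* First derivative of the invariance relation: phi' y' + phi y'' = sigma' y + (sigma + lambda)
     y'. *)
  assert (R2 := derivative_on_eq a b _ _ _ _
    (fun t Ht => C_is_derive_mult _ _ _ _ _ (Dp t Ht) (Hy1 t Ht))
    (fun t Ht => C_is_derive_mult _ _ _ _ _ (Ds t Ht) (Hy t Ht)) R1).
  assert (R3 := derivative_on_eq a b _ _ _ _
    (fun t Ht => C_is_derive_plus _ _ _ _ _
       (C_is_derive_mult _ _ _ _ _ (Dp1 t Ht) (Hy1 t Ht))
       (C_is_derive_mult _ _ _ _ _ (Dp t Ht) (Hy2 t Ht)))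
    (fun t Ht => C_is_derive_plus _ _ _ _ _
       (C_is_derive_mult _ _ _ _ _ (Ds1 t Ht) (Hy t Ht))
       (C_is_derive_mult _ _ _ _ _ (Ds t Ht) (Hy1 t Ht))) R2).
  intros x Hx. specialize (R1 x Hx). specialize (R2 x Hx). specialize (R3 x Hx).
  cbv beta in R1, R2, R3.
  assert (Hp : RtoC (phi x) <> 0%C).
  { intros H. apply RtoC_inj in H. exact (hphi0 x Hx H). }
  unfold coef3, coef2, coef1, coef0.
  (* The coefficient of y' contains (phi sigma)'; expanding it leaves only the derivatives of [phi]
     and [sigma] themselves. *)
  rewrite Derive_mult; [| eexists; apply (smooth_on_is_derive _ _ _ hphi Hx)
                        | eexists; apply (smooth_on_is_derive _ _ _ hsigma Hx)].
  fold p1 p2 s1 s2.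
  unfold Rminus.
  repeat rewrite ?RtoC_plus, ?RtoC_opp, ?RtoC_mult, ?RtoC_pow.
  revert R1 R2 R3 Hp.
  (* At a fixed point the claim is pure algebra over the complex numbers, so all function values
     become independent variables tied only by [R1], [R2], [R3]. *)
  generalize (RtoC (phi x)) (RtoC (p1 x)) (RtoC (p2 x))
    (RtoC (sigma x)) (RtoC (s1 x)) (RtoC (s2 x)) (y x) (y1 x) (y2 x) (y3 x).
  intros p p' p'' s s' s'' z z1 z2 z3 R1 R2 R3 Hp.
  (* The three relations form a triangular system, solved for one derivative of y at a time; the
     pivot is always [p]. *)
  assert (E1 : z1 = ((s + lambda) * z / p)%C).
  { rewrite <- R1. field. exact Hp. }
  assert (E2 : z2 = ((s' * z + (s + lambda) * z1 - p' * z1) / p)%C).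
  { replace (s' * z + (s + lambda) * z1)%C with (p' * z1 + p * z2)%C
      by (rewrite R2; ring).
    field. exact Hp. }
  assert (E3 : z3 = ((s'' * z + 2 * s' * z1 + (s + lambda) * z2
                      - p'' * z1 - 2 * p' * z2) / p)%C).
  { replace (s'' * z + 2 * s' * z1 + (s + lambda) * z2)%C
      with (p'' * z1 + p' * z2 + (p' * z2 + p * z3))%C
      by (rewrite R3; ring).
    field. exact Hp. }
  (* Substituting from the highest derivative down leaves a rational identity in [z] whose
     denominators are powers of [p]. *)
  rewrite E3, E2, E1. field. exact Hp.
Qed.

(** * Existence of the exponential solution and of its derivatives *)

(** As [phi] is real, the division acts componentwise, so the real and imaginary parts are
    integrated separately. *)
Lemma quotient_antiderivative (a b : Rbar) (phi sigma : R -> R) (lambda : C) :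
  Rbar_lt a b ->
  smooth_on (Rbar_interval a b) phi ->
  smooth_on (Rbar_interval a b) sigma ->
  (forall x, Rbar_interval a b x -> phi x <> 0) ->
  exists G : R -> C,
    antiderivative_on (Rbar_interval a b)
      (fun x => ((RtoC (sigma x) + lambda) / RtoC (phi x))%C) G.
Proof.
  intros hab hphi hsigma hphi0.
  destruct (continuous_antiderivative a b (fun x => (sigma x + Re lambda) / phi x) hab)
    as [F HF].
  { intros x Hx. apply (ex_derive_continuous (V := R_NormedModule)).
    auto_derive. repeat split.
    - eexists. apply (smooth_on_is_derive _ _ _ hsigma Hx).
    - eexists. apply (smooth_on_is_derive _ _ _ hphi Hx).
    - exact (hphi0 x Hx). }
  destruct (continuous_antiderivative a b (fun x => Im lambda / phi x) hab)
    as [H HH].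
  { intros x Hx. apply (ex_derive_continuous (V := R_NormedModule)).
    auto_derive. repeat split.
    - eexists. apply (smooth_on_is_derive _ _ _ hphi Hx).
    - exact (hphi0 x Hx). }
  exists (fun x => (F x, H x)). intros x Hx.
  replace ((RtoC (sigma x) + lambda) / RtoC (phi x))%C
    with (((sigma x + Re lambda) / phi x, Im lambda / phi x) : C).
  - apply C_is_derive_pair; [apply HF | apply HH]; exact Hx.
  - assert (Hp := hphi0 x Hx). unfold Cdiv. rewrite <- RtoC_inv by exact Hp.
    unfold Cmult, Cplus, RtoC. cbn. unfold Re, Im. f_equal; field; exact Hp.
Qed.

Lemma C_inv_smooth_derivatives (I : R -> Prop) (phi : R -> R) :
  smooth_on I phi -> (forall x, I x -> phi x <> 0) ->
  exists q1 q2 : R -> C,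
    derivative_on I (fun x => RtoC (/ phi x)) q1 /\ derivative_on I q1 q2.
Proof.
  intros hphi hphi0.
  exists (fun x => RtoC (- Derive phi x / phi x ^ 2)).
  exists (fun x => RtoC (Derive (fun t => - Derive phi t / phi t ^ 2) x)).
  split; intros x Hx; apply C_is_derive_RtoC.
  - apply is_derive_inv; [exact (smooth_on_is_derive _ _ _ hphi Hx) | exact (hphi0 x Hx)].
  - apply Derive_correct.
    apply (ex_derive_div (fun t => - Derive phi t) (fun t => phi t ^ 2)).
    + apply (ex_derive_opp (V := R_NormedModule) (Derive phi)).
      eexists. exact (smooth_on_is_derive_2 _ _ _ hphi Hx).
    + apply ex_derive_pow. eexists. exact (smooth_on_is_derive _ _ _ hphi Hx).
    + apply pow_nonzero. exact (hphi0 x Hx).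
Qed.

(** With w = (sigma + lambda) / phi the exponential satisfies y' = w y. Three derivatives of y thus
    require two of w, which come from the product rule applied to 1 / phi and sigma + lambda. *)
Lemma exponential_derivatives (I : R -> Prop) (phi sigma : R -> R) (lambda : C)
  (G : R -> C) :
  smooth_on I phi -> smooth_on I sigma -> (forall x, I x -> phi x <> 0) ->
  antiderivative_on I (fun x => ((RtoC (sigma x) + lambda) / RtoC (phi x))%C) G ->
  exists y1 y2 y3 : R -> C,
    derivative_on I (fun x => Cexp (G x)) y1 /\
    derivative_on I y1 y2 /\ derivative_on I y2 y3.
Proof.
  intros hphi hsigma hphi0 HG.
  destruct (C_inv_smooth_derivatives I phi hphi hphi0) as (q1 & q2 & Dq & Dq1).
  set (q := fun x => RtoC (/ phi x)).
  set (L := fun x => (RtoC (sigma x) + lambda)%C).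
  set (L1 := fun x => (RtoC (Derive sigma x) + 0)%C).
  set (L2 := fun x => (RtoC (Derive_n sigma 2 x) + 0)%C).
  assert (DL : derivative_on I L L1).
  { intros x Hx. apply C_is_derive_plus; [| apply C_is_derive_const].
    apply C_is_derive_RtoC. exact (smooth_on_is_derive _ _ _ hsigma Hx). }
  assert (DL1 : derivative_on I L1 L2).
  { intros x Hx. apply C_is_derive_plus; [| apply C_is_derive_const].
    apply C_is_derive_RtoC. exact (smooth_on_is_derive_2 _ _ _ hsigma Hx). }
  set (w := fun x => (q x * L x)%C).
  set (w1 := fun x => (q1 x * L x + q x * L1 x)%C).
  set (w2 := fun x => ((q2 x * L x + q1 x * L1 x) + (q1 x * L1 x + q x * L2 x))%C).
  assert (Dw : derivative_on I w w1).
  { intros x Hx. exact (C_is_derive_mult _ _ _ _ _ (Dq x Hx) (DL x Hx)). }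
  assert (Dw1 : derivative_on I w1 w2).
  { intros x Hx.
    exact (C_is_derive_plus _ _ _ _ _
      (C_is_derive_mult _ _ _ _ _ (Dq1 x Hx) (DL x Hx))
      (C_is_derive_mult _ _ _ _ _ (Dq x Hx) (DL1 x Hx))). }
  set (y := fun x => Cexp (G x)).
  set (y1 := fun x => (w x * y x)%C).
  set (y2 := fun x => (w1 x * y x + w x * y1 x)%C).
  set (y3 := fun x => ((w2 x * y x + w1 x * y1 x) + (w1 x * y1 x + w x * y2 x))%C).
  assert (Dy : derivative_on I y y1).
  { intros x Hx. assert (H := C_is_derive_Cexp _ _ _ (HG x Hx)). cbv beta in H.
    unfold y1, w, q, L. rewrite RtoC_inv by exact (hphi0 x Hx).
    rewrite (Cmult_comm (/ RtoC (phi x))). exact H. }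
  assert (Dy1 : derivative_on I y1 y2).
  { intros x Hx. exact (C_is_derive_mult _ _ _ _ _ (Dw x Hx) (Dy x Hx)). }
  exists y1, y2, y3. split; [assumption | split; [assumption |]].
  intros x Hx.
  exact (C_is_derive_plus _ _ _ _ _
    (C_is_derive_mult _ _ _ _ _ (Dw1 x Hx) (Dy x Hx))
    (C_is_derive_mult _ _ _ _ _ (Dw x Hx) (Dy1 x Hx))).
Qed.

Theorem theorem2p10p2 (a b : Rbar) (hab : Rbar_lt a b) (phi sigma : R -> R)
  (hphi : smooth_on (Rbar_interval a b) phi)
  (hsigma : smooth_on (Rbar_interval a b) sigma)
  (hphi0 : forall x : R, Rbar_interval a b x -> phi x <> 0)
  (A B C0 lambda : C) :
  (exists G : R -> C,
     antiderivative_on (Rbar_interval a b)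
       (fun x : R => ((RtoC (sigma x) + lambda) / RtoC (phi x))%C) G) /\
  (forall G : R -> C,
     antiderivative_on (Rbar_interval a b)
       (fun x : R => ((RtoC (sigma x) + lambda) / RtoC (phi x))%C) G ->
     invariant_on (Rbar_interval a b) phi sigma lambda
       (fun x : R => Cexp (G x)) /\
     (solution_on (Rbar_interval a b) phi sigma A B C0
        (fun x : R => Cexp (G x)) <->
      characteristic_root A B C0 lambda)).
Proof.
  split; [apply quotient_antiderivative; assumption |].
  intros G HG.
  (* The derivative is left arbitrary because [solution_on] brings its own witnesses; uniqueness of
     derivatives on the interval identifies them with that of the exponential. *)
  assert (Hinv : forall y1 : R -> C,
    derivative_on (Rbar_interval a b) (fun x => Cexp (G x)) y1 ->
    forall x, Rbar_interval a b x ->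
      (RtoC (phi x) * y1 x = (RtoC (sigma x) + lambda) * Cexp (G x))%C).
  { intros y1 Hy1 x Hx.
    rewrite (C_is_derive_unique _ _ _ _ (Hy1 x Hx) (C_is_derive_Cexp _ _ _ (HG x Hx))).
    field. intros H. apply RtoC_inj in H. exact (hphi0 x Hx H). }
  destruct (exponential_derivatives _ _ _ _ _ hphi hsigma hphi0 HG)
    as (y1 & y2 & y3 & D1 & D2 & D3).
  split; [exists y1; split; [exact D1 | exact (Hinv y1 D1)] |].
  unfold characteristic_root. split.
  - intros (z1 & z2 & z3 & E1 & E2 & E3 & Heq).
    (* The characteristic polynomial at [lambda] does not depend on x, so a single point of the
       interval suffices to show that it vanishes. *)
    destruct (Rbar_interval_inhabited _ _ hab) as [x Hx].
    specialize (Heq x Hx).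
    rewrite (invariant_equation_lhs a b phi sigma A B C0 lambda _ z1 z2 z3
      hphi hsigma hphi0 E1 E2 E3 (Hinv z1 E1) x Hx) in Heq.
    assert (HE := Cexp_neq_0 (G x)).
    set (P := (lambda ^ 3 + A * lambda ^ 2 + B * lambda + C0)%C) in *.
    replace P with (P * Cexp (G x) / Cexp (G x))%C by (field; exact HE).
    rewrite Heq. apply Cmult_0_l.
  - intros Hroot. exists y1, y2, y3.
    split; [exact D1 | split; [exact D2 | split; [exact D3 |]]].
    intros x Hx.
    rewrite (invariant_equation_lhs a b phi sigma A B C0 lambda _ y1 y2 y3
      hphi hsigma hphi0 D1 D2 D3 (Hinv y1 D1) x Hx).
    rewrite Hroot. apply Cmult_0_l.
Qed.
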